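(* A topological $\mathbb{BC}$-module $(X,\tau)$ is $\mathbb{D}$-normable if and only if it contains a bounded $\mathbb{BC}$-convex neighbourhood of $0$.
   Context: Bicomplex numbers: $\mathbb{BC} = \{w_1 + j w_2 : w_1, w_2 \in \mathbb{C}(i)\}$, where $\mathbb{C}(i)$ is the field of complex numbers with imaginary unit $i$; it is a commutative ring with $i^2=j^2=-1$, $ij=ji=k$, $k^2=1$. Put $e_1=(1+k)/2$, $e_2=(1-k)/2$, so $e_1^2=e_1$, $e_2^2=e_2$, $e_1e_2=0$, $e_1+e_2=1$. Every $Z\in\mathbb{BC}$ is uniquely $Z=e_1z_1+e_2z_2$ with $z_1,z_2\in\mathbb{C}(i)$; $\mathbb{BC}$ carries the topology of the Euclidean norm $|Z|=\sqrt{(|z_1|^2+|z_2|^2)/2}$. Hyperbolic numbers: $\mathbb{D}=\{e_1\alpha_1+e_2\alpha_2:\alpha_1,\alpha_2\in\mathbb{R}\}\subset\mathbb{BC}$; $\mathbb{D}^+=\{e_1\alpha_1+e_2\alpha_2:\alpha_1,\alpha_2\ge 0\}$. For $\alpha,\gamma\in\mathbb{D}$: $\alpha\leq'\gamma$ means $\gamma-\alpha\in\mathbb{D}^+$; $\alpha<'\gamma$ means $\gamma-\alpha=e_1a+e_2b$ with real $a,b>0$. The hyperbolic modulus is $|e_1z_1+e_2z_2|_k=e_1|z_1|+e_2|z_2|$. A topological $\mathbb{BC}$-module is a $\mathbb{BC}$-module $X$ with a Hausdorff topology $\tau$ such that addition $X\times X\to X$ and scalar multiplication $\mathbb{BC}\times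 X\to X$ are continuous. A subset $B\subset X$ is $\mathbb{BC}$-convex if $\lambda x+(1-\lambda)y\in B$ for all $x,y\in B$ and $\lambda\in\mathbb{D}^+$ with $0\leq'\lambda\leq'1$. A subset $B\subset X$ is bounded if for each neighbourhood $U$ of $0$ there exists $\lambda\in\mathbb{D}$, $\lambda>'0$, such that $B\subset\lambda U$. A $\mathbb{D}$-valued norm on $X$ is a function $\|\cdot\|_{\mathbb{D}}:X\to\mathbb{D}^+$ such that for all $x,y\in X$, $z\in\mathbb{BC}$: $\|x\|_{\mathbb{D}}=0$ iff $x=0$; $\|zx\|_{\mathbb{D}}=|z|_k\|x\|_{\mathbb{D}}$; $\|x+y\|_{\mathbb{D}}\leq'\|x\|_{\mathbb{D}}+\|y\|_{\mathbb{D}}$. The topology it generates has as base the balls $\{y:\|y-x\|_{\mathbb{D}}<'\epsilon\}$, $x\in X$, $\epsilon>'0$. A topological $\mathbb{BC}$-module is $\mathbb{D}$-normable (hyperbolic normable) if its topology is generated by a $\mathbb{D}$-valued norm. *)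

(* Defs.v *)
From HB Require Import structures.
From mathcomp Require Import all_boot all_order all_algebra.
From mathcomp Require Import all_classical all_reals all_analysis.
From mathcomp Require Import complex ring.

Set Implicit Arguments.
Unset Strict Implicit.
Unset Printing Implicit Defensive.

Import Order.TTheory GRing.Theory Num.Theory.
Import numFieldNormedType.Exports.
Import ComplexField.Normc.

Local Open Scope classical_set_scope.
Local Open Scope ring_scope.
Local Open Scope complex_scope.

(* [Bicomplex w1 w2] stands for w1 + j w2. *)
Record bicomplex (R : Type) : Type := Bicomplex { bc1 : R[i]; bc2 : R[i] }.

Section BicomplexRing.
Variable R : realType.
Local Notation BC := (bicomplex R).

Definition bc_pair (Z : BC) : R[i] * R[i] := (bc1 Z, bc2 Z).
Definition pair_bc (w : R[i] * R[i]) : BC := Bicomplex w.1 w.2.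

Lemma bc_pairK : cancel bc_pair pair_bc.
Proof. by case. Qed.

HB.instance Definition _ := Equality.copy BC (can_type bc_pairK).
HB.instance Definition _ := Choice.copy BC (can_type bc_pairK).

Definition addbc (Z W : BC) : BC :=
  Bicomplex (bc1 Z + bc1 W) (bc2 Z + bc2 W).
Definition oppbc (Z : BC) : BC := Bicomplex (- bc1 Z) (- bc2 Z).
Definition mulbc (Z W : BC) : BC :=
  Bicomplex (bc1 Z * bc1 W - bc2 Z * bc2 W) (bc1 Z * bc2 W + bc2 Z * bc1 W).

Fact addbcA : associative addbc.
Proof. by move=> [a b] [c d] [e f]; rewrite /addbc /= !addrA. Qed.

Fact addbcC : commutative addbc.
Proof.
by move=> [a b] [c d]; rewrite /addbc /=; congr Bicomplex; rewrite addrC.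
Qed.

Fact add0bc : left_id (Bicomplex 0 0) addbc.
Proof. by move=> [a b]; rewrite /addbc /= !add0r. Qed.

Fact addNbc : left_inverse (Bicomplex 0 0) oppbc addbc.
Proof. by move=> [a b]; rewrite /addbc /= !addNr. Qed.

HB.instance Definition _ :=
  GRing.isZmodule.Build BC addbcA addbcC add0bc addNbc.

Fact mulbcA : associative mulbc.
Proof. by move=> [a b] [c d] [e f]; congr Bicomplex => /=; ring. Qed.

Fact mulbcC : commutative mulbc.
Proof. by move=> [a b] [c d]; congr Bicomplex => /=; ring. Qed.

Fact mul1bc : left_id (Bicomplex 1 0) mulbc.
Proof. by move=> [a b]; congr Bicomplex => /=; ring. Qed.

Fact mulbcDl : left_distributive mulbc +%R.
Proof. by move=> [a b] [c d] [e f]; congr Bicomplex => /=; ring. Qed.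

Fact onebc_neq0 : Bicomplex 1 0 != 0 :> BC.
Proof. by apply/eqP => -[/eqP]; rewrite oner_eq0. Qed.

HB.instance Definition _ := GRing.Zmodule_isComNzRing.Build BC
  mulbcA mulbcC mul1bc mulbcDl onebc_neq0.

Definition bc_of_complex (w : R[i]) : BC := Bicomplex w 0.
Definition bc_i : BC := bc_of_complex 'i.
Definition bc_j : BC := Bicomplex 0 1.
Definition bc_k : BC := bc_i * bc_j.

Definition e1 : BC := bc_of_complex 2^-1 * (1 + bc_k).
Definition e2 : BC := bc_of_complex 2^-1 * (1 - bc_k).

(* The components z1, z2 of Z = e1 z1 + e2 z2 (see [idemE], [idem_uniq]). *)
Definition idem1 (Z : BC) : R[i] := bc1 Z - 'i * bc2 Z.
Definition idem2 (Z : BC) : R[i] := bc1 Z + 'i * bc2 Z.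

Lemma idem1D Z W : idem1 (Z + W) = idem1 Z + idem1 W.
Proof. by rewrite /idem1 /= mulrDr opprD addrACA. Qed.

Lemma idem2D Z W : idem2 (Z + W) = idem2 Z + idem2 W.
Proof. by rewrite /idem2 /= mulrDr addrACA. Qed.

Lemma idem1N Z : idem1 (- Z) = - idem1 Z.
Proof. by rewrite /idem1 /= mulrN opprD. Qed.

Lemma idem2N Z : idem2 (- Z) = - idem2 Z.
Proof. by rewrite /idem2 /= mulrN opprD. Qed.

Lemma idem1Mn Z n : idem1 (Z *+ n) = idem1 Z *+ n.
Proof.
elim: n => [|n IHn]; first by rewrite !mulr0n /idem1 /= mulr0 subr0.
by rewrite !mulrS idem1D IHn.
Qed.

Lemma idem2Mn Z n : idem2 (Z *+ n) = idem2 Z *+ n.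
Proof.
elim: n => [|n IHn]; first by rewrite !mulr0n /idem2 /= mulr0 addr0.
by rewrite !mulrS idem2D IHn.
Qed.

Let mulii : 'i * 'i = -1 :> R[i].
Proof. by rewrite -expr2 sqr_i. Qed.

Lemma idem1M Z W : idem1 (Z * W) = idem1 Z * idem1 W.
Proof.
rewrite /idem1 /=.
have -> : (bc1 Z - 'i * bc2 Z) * (bc1 W - 'i * bc2 W) =
  bc1 Z * bc1 W + ('i * 'i) * (bc2 Z * bc2 W)
  - 'i * (bc1 Z * bc2 W + bc2 Z * bc1 W) by ring.
by rewrite mulii mulN1r.
Qed.

Lemma idem2M Z W : idem2 (Z * W) = idem2 Z * idem2 W.
Proof.
rewrite /idem2 /=.
have -> : (bc1 Z + 'i * bc2 Z) * (bc1 W + 'i * bc2 W) =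
  bc1 Z * bc1 W + ('i * 'i) * (bc2 Z * bc2 W)
  + 'i * (bc1 Z * bc2 W + bc2 Z * bc1 W) by ring.
by rewrite mulii mulN1r.
Qed.

Lemma idem_inj Z W : idem1 Z = idem1 W -> idem2 Z = idem2 W -> Z = W.
Proof.
case: Z W => [a b] [c d]; rewrite /idem1 /idem2 /= => E1 E2.
have two0 : (2 : R[i]) != 0 by rewrite pnatr_eq0.
have Eac : a = c.
  apply: (mulfI two0); have := congr2 +%R E1 E2.
  by rewrite !mulr_natl !mulr2n addrACA addNr addr0 addrACA addNr addr0.
rewrite {}Eac in E2 *; congr Bicomplex.
by move/addrI/mulfI: E2; apply; rewrite eq_complex /= oner_eq0 andbF.
Qed.

Lemma idem1_e (z1 z2 : R[i]) :
  idem1 (e1 * bc_of_complex z1 + e2 * bc_of_complex z2) = z1.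
Proof.
have h : 2^-1 + 2^-1 = 1 :> R[i] by have := splitr (1 : R[i]); rewrite !mul1r => <-.
rewrite idem1D !idem1M !idem1D idem1N idem1M /idem1 /=.
rewrite !(mulr0, mul0r, mulr1, subr0, sub0r, mulrN, mulii, opprK).
by rewrite subrr mulr0 mul0r addr0 mulrDr mulr1 h mul1r.
Qed.

Lemma idem2_e (z1 z2 : R[i]) :
  idem2 (e1 * bc_of_complex z1 + e2 * bc_of_complex z2) = z2.
Proof.
have h : 2^-1 + 2^-1 = 1 :> R[i] by have := splitr (1 : R[i]); rewrite !mul1r => <-.
rewrite idem2D !idem2M !idem2D idem2N idem2M /idem2 /=.
rewrite !(mulr0, mul0r, mulr1, addr0, add0r, mulii, opprK).
by rewrite subrr mulr0 mul0r add0r mulrDr mulr1 h mul1r.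
Qed.

Lemma idemE Z : Z = e1 * bc_of_complex (idem1 Z) + e2 * bc_of_complex (idem2 Z).
Proof. by apply: idem_inj; rewrite ?idem1_e ?idem2_e. Qed.

Lemma idem_uniq Z z1 z2 : Z = e1 * bc_of_complex z1 + e2 * bc_of_complex z2 ->
  z1 = idem1 Z /\ z2 = idem2 Z.
Proof. by move=> ->; rewrite idem1_e idem2_e. Qed.

Definition bc_norm Z : R :=
  Num.sqrt ((normc (idem1 Z) ^+ 2 + normc (idem2 Z) ^+ 2) / 2).

Let bc_normE Z :
  bc_norm Z = normc (normc (idem1 Z) +i* normc (idem2 Z)) / Num.sqrt 2.
Proof.
by rewrite /bc_norm sqrtrM ?addr_ge0 ?sqr_ge0 //= sqrtrV ?ler0n.
Qed.

Let normc_ge0 (z : R[i]) : 0 <= normc z.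
Proof. by case: z => a b; exact: sqrtr_ge0. Qed.

Fact ler_bc_normD Z W : bc_norm (Z + W) <= bc_norm Z + bc_norm W.
Proof.
rewrite !bc_normE -mulrDl ler_wpM2r ?invr_ge0 ?sqrtr_ge0 //.
apply: le_trans (le_normcD _ _) => /=.
rewrite ler_wsqrtr // lerD // lerXn2r ?nnegrE ?addr_ge0 ?normc_ge0 //.
  by rewrite idem1D le_normcD.
by rewrite idem2D le_normcD.
Qed.

Fact bc_norm_eq0 Z : bc_norm Z = 0 -> Z = 0.
Proof.
have sqrt2 : Num.sqrt 2 != 0 :> R by rewrite gt_eqF // sqrtr_gt0 ltr0n.
rewrite bc_normE => /eqP.
rewrite mulf_eq0 invr_eq0 (negPf sqrt2) orbF => /eqP /eq0_normc [n1 n2].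
apply: idem_inj; [rewrite (eq0_normc n1)|rewrite (eq0_normc n2)].
  by rewrite /idem1 /= mulr0 subr0.
by rewrite /idem2 /= mulr0 addr0.
Qed.

Fact bc_normMn Z n : bc_norm (Z *+ n) = bc_norm Z *+ n.
Proof.
have cMn (a b : R) : (a +i* b) *+ n = (a *+ n) +i* (b *+ n).
  by elim: n => [|n IHn]; rewrite ?mulr0n // !mulrS IHn.
by rewrite !bc_normE idem1Mn idem2Mn 2!normcMn -cMn normcMn mulrnAl.
Qed.

Fact bc_normN Z : bc_norm (- Z) = bc_norm Z.
Proof. by rewrite !bc_normE idem1N idem2N !normcN. Qed.

HB.instance Definition _ := Num.Zmodule_isNormed.Build R BC
  ler_bc_normD bc_norm_eq0 bc_normMn bc_normN.
HB.instance Definition _ := PseudoMetric.copy BC (pseudoMetric_normed BC).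
HB.instance Definition _ := isPointed.Build BC 0.
HB.instance Definition _ := NormedZmod_PseudoMetric_eq.Build R BC erefl.

Definition hyp (a1 a2 : R) : BC :=
  e1 * bc_of_complex a1%:C + e2 * bc_of_complex a2%:C.

Definition hyperbolic : set BC := [set Z | exists a1 a2, Z = hyp a1 a2].

Definition hyp_nneg : set BC :=
  [set Z | exists a1 a2, [/\ 0 <= a1, 0 <= a2 & Z = hyp a1 a2]].

(* [hle] and [hlt] are only meant for hyperbolic arguments. *)
Definition hle (Z W : BC) : Prop := hyp_nneg (W - Z).

Definition hlt (Z W : BC) : Prop :=
  exists a b, [/\ 0 < a, 0 < b & W - Z = hyp a b].

Definition hmod (Z : BC) : BC := hyp (normc (idem1 Z)) (normc (idem2 Z)).

End BicomplexRing.

(* A topology, as a family of open sets. *)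
Definition topology_on (R : realType) (X : lmodType (bicomplex R)) : Type :=
  isOpenTopological X.

(* The library's topological-module structures require a [numDomainType] of
   scalars, which the ring of bicomplex numbers (it has zero divisors) is not.
   [topspace tau] is the module X carrying the topology tau. *)
Definition topspace (R : realType) (X : lmodType (bicomplex R))
  (tau : topology_on X) : Type := X.

HB.instance Definition _ (R : realType) (X : lmodType (bicomplex R))
  (tau : topology_on X) := GRing.Lmodule.on (topspace tau).
HB.instance Definition _ (R : realType) (X : lmodType (bicomplex R))
  (tau : topology_on X) : isOpenTopological (topspace tau) := tau.

Section BCModule.
Variables (R : realType) (X : lmodType (bicomplex R)).

Definition bc_convex (B : set X) : Prop :=
  forall (x y : X) (l : bicomplex R), B x -> B y ->
    hyp_nneg l -> hle 0 l -> hle l 1 -> B (l *: x + (1 - l) *: y).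

Record is_hnorm (N : X -> bicomplex R) : Prop := IsHnorm {
  hnorm_nneg : forall x, hyp_nneg (N x) ;
  hnorm_eq0 : forall x, N x = 0 <-> x = 0 ;
  hnormZ : forall (z : bicomplex R) x, N (z *: x) = hmod z * N x ;
  hnormD : forall x y, hle (N (x + y)) (N x + N y)
}.

Definition hball (N : X -> bicomplex R) (x : X) (eps : bicomplex R) : set X :=
  [set y | hlt (N (y - x)) eps].

End BCModule.

Section TopologicalBCModule.
Variables (R : realType) (X : lmodType (bicomplex R)).
Variable tau : topology_on X.

Record is_topological_module : Prop := IsTopologicalModule {
  topmod_hausdorff : hausdorff_space (topspace tau) ;
  topmod_add_continuous :
    continuous (fun p : topspace tau * topspace tau => p.1 + p.2) ;
  topmod_scale_continuous :
    continuous (fun p : bicomplex R * topspace tau => p.1 *: p.2)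
}.

Definition bc_bounded (B : set (topspace tau)) : Prop :=
  forall U : set (topspace tau), nbhs 0 U ->
    exists l : bicomplex R,
      [/\ hyperbolic l, hlt 0 l & B `<=` [set l *: u | u in U]].

Definition hnormable : Prop :=
  exists2 N : topspace tau -> bicomplex R, is_hnorm N &
    basis [set A : set (topspace tau) | exists x eps,
      [/\ hyperbolic eps, hlt 0 eps & A = hball N x eps]].

End TopologicalBCModule.

(* Main.v *)
Require Import Defs.
From mathcomp Require Import all_boot all_order all_algebra.
From mathcomp Require Import all_classical all_reals all_analysis.
From mathcomp Require Import complex ring lra.

Import Order.TTheory GRing.Theory Num.Theory.
Import ComplexField.Normc.

Local Open Scope classical_set_scope.
Local Open Scope ring_scope.
Local Open Scope complex_scope.

(** In idempotent coordinates the hyperbolic order and product are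
    componentwise, so a hyperbolic-valued norm is the same thing as a pair of
    real seminorms [n1], [n2], jointly separating points, on which [z] acts by
    the moduli of its two components ([hnorm_seminorm_pair] and
    [seminorm_pair_hnorm]).

    If such a norm generates the topology, its open unit ball is convex by the
    triangle inequality in each component, and it is bounded because every
    neighbourhood of 0 contains a ball centred at 0, which is an invertible
    positive hyperbolic multiple of the unit ball
    ([basis_bounded_convex_nbhs]).

    Conversely, this is Kolmogorov's normability argument. Given a bounded
    convex neighbourhood [B] of 0, keep the points all of whose multiples by
    scalars of hyperbolic modulus at most 1 stay in [B]. This core [C] is still
    convex and bounded, and joint continuity of the scalar multiplication at
    (0, 0) makes it a neighbourhood of 0 ([nbhs0_hcore]). Let [g] be the
    ordinary real Minkowski gauge of [C], a seminorm over the complex numbers,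
    and put [n1 x = g (e1 x)], [n2 x = g (e2 x)]. Multiplying by [z] on the
    range of [e1] is multiplying by the first component of [z], whence the
    homogeneity of [n1], and similarly for [n2]. Convexity with the weight [e1]
    glues a point with [n1 < 1] and [n2 < 1] back from its two components, so
    [C] lies between the open and the closed unit ball of the pair ([gauge_lt1],
    [gauge_le1]). Boundedness of [C] and the Hausdorff property then show that
    the pair separates points ([gauge_seminorm_pair]), and boundedness together
    with [C] being a neighbourhood of 0 shows that the balls form a base of the
    topology ([bounded_nbhs_basis]). *)

(** * Hyperbolic numbers in idempotent coordinates *)

Section Hyperbolic.
Context {R : realType}.
Local Notation BC := (bicomplex R).
Implicit Types (a b c d t : R) (z w : BC).

Lemma normc_ge0 (u : R[i]) : 0 <= normc u.
Proof. by case: u => a b; exact: sqrtr_ge0. Qed.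

Lemma normc_gt0 (u : R[i]) : u != 0 -> 0 < normc u.
Proof.
move=> u0; rewrite lt_neqAle normc_ge0 andbT eq_sym.
by apply: contra u0 => /eqP/eq0_normc ->.
Qed.

Lemma convex_lt1 a c d : 0 <= a -> a <= 1 -> c < 1 -> d < 1 ->
  a * c + (1 - a) * d < 1.
Proof.
rewrite le_eqVlt => /orP[/eqP <-|a0 a1 c1 d1].
  by rewrite mul0r add0r subr0 mul1r.
have : a * c < a * 1 by rewrite ltr_pM2l.
have : (1 - a) * d <= (1 - a) * 1 by rewrite ler_wpM2l ?subr_ge0 // ltW.
lra.
Qed.

Lemma normc_real a : normc a%:C = `|a|.
Proof. by rewrite /normc /= expr0n /= addr0 sqrtr_sqr. Qed.

Lemma idem1_hyp a b : idem1 (hyp a b) = a%:C.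
Proof. exact: idem1_e. Qed.

Lemma idem2_hyp a b : idem2 (hyp a b) = b%:C.
Proof. exact: idem2_e. Qed.

Definition idem_hyp := (idem1_hyp, idem2_hyp).

Lemma hyp_inj a b c d : hyp a b = hyp c d -> a = c /\ b = d.
Proof.
move=> E; split.
  by have := congr1 (@idem1 R) E; rewrite !idem_hyp => -[].
by have := congr1 (@idem2 R) E; rewrite !idem_hyp => -[].
Qed.

Lemma hypM a b c d : hyp a b * hyp c d = hyp (a * c) (b * d).
Proof.
by apply: idem_inj; rewrite ?idem1M ?idem2M !idem_hyp -rmorphM.
Qed.

Lemma hypD a b c d : hyp a b + hyp c d = hyp (a + c) (b + d).
Proof.
by apply: idem_inj; rewrite ?(idem1D (hyp a b)) ?(idem2D (hyp a b)) !idem_hyp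
  -rmorphD.
Qed.

Lemma hypB a b c d : hyp a b - hyp c d = hyp (a - c) (b - d).
Proof.
by apply: idem_inj; rewrite ?(idem1D (hyp a b)) ?(idem2D (hyp a b)) ?idem1N
  ?idem2N !idem_hyp -rmorphB.
Qed.

Lemma idem1_complex (u : R[i]) : idem1 (bc_of_complex u) = u.
Proof. by rewrite /idem1 /= mulr0 subr0. Qed.

Lemma idem2_complex (u : R[i]) : idem2 (bc_of_complex u) = u.
Proof. by rewrite /idem2 /= mulr0 addr0. Qed.

Lemma hyp_real t : hyp t t = bc_of_complex t%:C.
Proof. by apply: idem_inj; rewrite !idem_hyp ?idem1_complex ?idem2_complex. Qed.

Lemma hyp00 : hyp 0 0 = 0 :> BC.
Proof. by rewrite hyp_real. Qed.

Lemma hyp11 : hyp 1 1 = 1 :> BC.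
Proof. by rewrite hyp_real. Qed.

Lemma hypVK a b : 0 < a -> 0 < b -> hyp a^-1 b^-1 * hyp a b = 1.
Proof. by move=> a0 b0; rewrite hypM !mulVf ?gt_eqF // hyp11. Qed.

Lemma hyp_nnegE a b : hyp_nneg (hyp a b) <-> 0 <= a /\ 0 <= b.
Proof.
split=> [[c [d [c0 d0 /hyp_inj[-> ->]]]] //|[a0 b0]].
by exists a, b.
Qed.

Lemma hleE a b c d : hle (hyp a b) (hyp c d) <-> a <= c /\ b <= d.
Proof. by rewrite /hle hypB hyp_nnegE !subr_ge0. Qed.

Lemma hltE a b c d : hlt (hyp a b) (hyp c d) <-> a < c /\ b < d.
Proof.
rewrite /hlt hypB -[a < c]subr_gt0 -[b < d]subr_gt0.
split=> [[u [v [u0 v0 /hyp_inj[-> ->]]]] //|[u0 v0]].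
by exists (c - a), (d - b).
Qed.

Lemma hlt0E z : hlt 0 z <-> exists a b, [/\ 0 < a, 0 < b & z = hyp a b].
Proof. by rewrite /hlt subr0. Qed.

(** The condition that the hyperbolic modulus of [z] is at most 1. *)
Definition hdisc z : Prop := normc (idem1 z) <= 1 /\ normc (idem2 z) <= 1.

Lemma hdisc_hyp a b : 0 <= a <= 1 -> 0 <= b <= 1 -> hdisc (hyp a b).
Proof.
move=> /andP[a0 a1] /andP[b0 b1]; rewrite /hdisc !idem_hyp !normc_real.
by rewrite !ger0_norm.
Qed.

Lemma hdisc1 : hdisc 1.
Proof. by rewrite -hyp11; apply: hdisc_hyp; rewrite ler01 lexx. Qed.

Lemma hdiscM z w : hdisc z -> hdisc w -> hdisc (z * w).
Proof.
move=> [z1 z2] [w1 w2]; rewrite /hdisc idem1M idem2M !normcM.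
by rewrite !mulr_ile1 ?normc_ge0.
Qed.

Lemma bc_norm_hdisc t z : 0 <= t -> hdisc z -> `|hyp t t * z| <= t.
Proof.
move=> t0 [z1 z2]; rewrite /Num.norm /= /bc_norm idem1M idem2M !idem_hyp.
rewrite !normcM !normc_real (ger0_norm t0) -[leRHS](ger0_norm t0) -sqrtr_sqr.
rewrite ler_wsqrtr //.
have h (u : R[i]) : normc u <= 1 -> (t * normc u) ^+ 2 <= t ^+ 2.
  move=> u1; rewrite ler_sqr ?nnegrE ?mulr_ge0 ?normc_ge0 //.
  by rewrite ler_piMr.
by rewrite ler_pdivrMr // mulr_natr mulr2n lerD ?h.
Qed.

(** The hyperbolic disc lies in the closed Euclidean unit ball
    ([bc_norm_hdisc]), so it shrinks to 0 under small real factors. *)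
Lemma nbhs0_hdisc (A : set BC) : nbhs (0 : BC) A ->
  exists2 t, 0 < t & forall z, hdisc z -> A (hyp t t * z).
Proof.
move=> /nbhs_normP[e /= e0 eA]; exists (e / 2); first by rewrite divr_gt0.
move=> z dz; apply: eA; rewrite /ball_ /= sub0r normrN.
apply: le_lt_trans (bc_norm_hdisc _ _ _ dz) _; first by rewrite divr_ge0 // ltW.
by rewrite gtr_pMr // invf_lt1 // ltr1n.
Qed.

End Hyperbolic.

(** * Norms with hyperbolic values as pairs of seminorms *)

Section Norm.
Context {R : realType} {X : lmodType (bicomplex R)}.
Implicit Types (x y : X) (z : bicomplex R).

Record seminorm_pair (n1 n2 : X -> R) : Prop := SeminormPair {
  pair_ge0 : forall x, 0 <= n1 x /\ 0 <= n2 x ;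
  pair_eq0 : forall x, n1 x = 0 -> n2 x = 0 -> x = 0 ;
  pairZ : forall z x, n1 (z *: x) = normc (idem1 z) * n1 x /\
                      n2 (z *: x) = normc (idem2 z) * n2 x ;
  pairD : forall x y, n1 (x + y) <= n1 x + n1 y /\ n2 (x + y) <= n2 x + n2 y
}.

Lemma seminorm_pair_hnorm n1 n2 : seminorm_pair n1 n2 ->
  is_hnorm (fun x => hyp (n1 x) (n2 x)).
Proof.
move=> [n0 neq0 nZ nD]; split=> [x|x|z x|x y].
- exact/hyp_nnegE.
- split=> [|->]; first by rewrite -hyp00 => /hyp_inj[]; exact: neq0.
  rewrite -(scale0r 0) -hyp00; have [-> ->] := nZ (hyp 0 0) 0.
  by rewrite !idem_hyp normc_real normr0 !mul0r.
- by rewrite /hmod hypM; have [-> ->] := nZ z x.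
- by rewrite hypD; apply/hleE.
Qed.

(** The components are chosen pointwise; uniqueness of idempotent coordinates
    turns each norm axiom into its two componentwise versions. *)
Lemma hnorm_seminorm_pair N : is_hnorm N ->
  exists n1 n2, seminorm_pair n1 n2 /\ N = (fun x => hyp (n1 x) (n2 x)).
Proof.
move=> [N0 Neq0 NZ ND].
have /choice[n nE] x : exists p : R * R, N x = hyp p.1 p.2.
  by have [a [b [_ _ ->]]] := N0 x; exists (a, b).
exists (fun x => (n x).1), (fun x => (n x).2); split; last exact/funext.
split=> [x|x|z x|x y].
- by apply/hyp_nnegE; rewrite -nE.
- by move=> n1 n2; apply/Neq0; rewrite nE n1 n2 hyp00.
- by apply: hyp_inj; rewrite -nE NZ nE /hmod hypM.
- by apply/hleE; rewrite -hypD -!nE.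
Qed.

Lemma pair_hyp {n1 n2} : seminorm_pair n1 n2 ->
  forall a b x, 0 <= a -> 0 <= b ->
  n1 (hyp a b *: x) = a * n1 x /\ n2 (hyp a b *: x) = b * n2 x.
Proof.
move=> [_ _ nZ _] a b x a0 b0; have [-> ->] := nZ (hyp a b) x.
by rewrite !idem_hyp !normc_real !ger0_norm.
Qed.

End Norm.

(** * Balanced cores and gauges *)

Section Gauge.
Context {R : realType} {X : lmodType (bicomplex R)}.
Implicit Types (x y : X) (z : bicomplex R) (C : set X) (t : R).

Definition hbalanced C : Prop := forall z x, hdisc z -> C x -> C (z *: x).

(** The balanced core: the largest balanced subset of [C]. *)
Definition hcore C : set X := [set x | forall z, hdisc z -> C (z *: x)].

Lemma hcore_sub C : hcore C `<=` C.
Proof. by move=> x /(_ 1 hdisc1); rewrite scale1r. Qed.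

Lemma hcore_balanced C : hbalanced (hcore C).
Proof.
by move=> z x dz Cx w dw; rewrite scalerA; apply: Cx; exact: hdiscM.
Qed.

Lemma hcore_convex C : bc_convex C -> bc_convex (hcore C).
Proof.
move=> Cconv x y l Cx Cy l0 le0 le1 z dz.
rewrite scalerDr !scalerA (mulrC z l) (mulrC z (1 - l)) -!scalerA.
by apply: Cconv => //; [exact: Cx|exact: Cy].
Qed.

Lemma bc_convex_hyp C a b x y : bc_convex C -> 0 <= a <= 1 -> 0 <= b <= 1 ->
  C x -> C y -> C (hyp a b *: x + hyp (1 - a) (1 - b) *: y).
Proof.
move=> Cconv /andP[a0 a1] /andP[b0 b1] Cx Cy; rewrite -hypB hyp11.
apply: Cconv => //; first exact/hyp_nnegE.
  by rewrite -hyp00; apply/hleE.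
by rewrite -hyp11; apply/hleE.
Qed.

(** The Minkowski functional of [C], with the real number [t] acting as the
    bicomplex scalar [hyp t t]. *)
Definition gauge C x : R := inf [set t | 0 < t /\ C (hyp t^-1 t^-1 *: x)].

Section GaugeTheory.
Variable C : set X.
Hypothesis Cabs : forall x, exists2 t, 0 < t & C (hyp t t *: x).
Hypothesis Cbal : hbalanced C.
Hypothesis Cconv : bc_convex C.

Let gauge_nonempty x : [set t | 0 < t /\ C (hyp t^-1 t^-1 *: x)] !=set0.
Proof.
by have [t t0 Ct] := Cabs x; exists t^-1; rewrite /= invr_gt0 invrK.
Qed.

Lemma gauge_ge0 x : 0 <= gauge C x.
Proof. by apply: lb_le_inf => // t [/ltW]. Qed.

Lemma gauge_le t x : 0 < t -> C (hyp t^-1 t^-1 *: x) -> gauge C x <= t.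
Proof. by move=> t0 Ct; apply: ge_inf => //; exists 0 => s [/ltW]. Qed.

(** The infimum gives some [s < t] with [x] in [s C], and [s C] lies in [t C]
    because [s / t] is in the disc. *)
Lemma gauge_lt t x : gauge C x < t -> C (hyp t^-1 t^-1 *: x).
Proof.
move=> /(inf_lt (gauge_nonempty x))[s [s0 Cs] st].
have t0 := lt_trans s0 st.
have -> : hyp t^-1 t^-1 = hyp (s / t) (s / t) * hyp s^-1 s^-1.
  by rewrite hypM mulrAC mulfV ?gt_eqF // mul1r.
rewrite -scalerA; apply: Cbal => //.
by apply: hdisc_hyp; rewrite divr_ge0 ?ler_pdivrMr ?mul1r // ltW.
Qed.

Lemma gaugeD x y : gauge C (x + y) <= gauge C x + gauge C y.
Proof.
apply/ler_addgt0Pr => e e0.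
set s := gauge C x + e / 2; set t := gauge C y + e / 2.
have e20 : 0 < e / 2 by rewrite divr_gt0.
have s0 : 0 < s by rewrite ltr_wpDl ?gauge_ge0.
have t0 : 0 < t by rewrite ltr_wpDl ?gauge_ge0.
have st0 : 0 < s + t by rewrite addr_gt0.
have Cs : C (hyp s^-1 s^-1 *: x) by apply: gauge_lt; rewrite ltrDl.
have Ct : C (hyp t^-1 t^-1 *: y) by apply: gauge_lt; rewrite ltrDl.
have -> : gauge C x + gauge C y + e = s + t.
  by rewrite /s /t addrACA -splitr.
apply: gauge_le => //.
(* the weight s / (s + t) rebuilds (x + y) / (s + t) from x / s and y / t *)
have l01 : 0 <= s / (s + t) <= 1.
  by rewrite divr_ge0 ?ler_pdivrMr ?mul1r ?lerDl // ltW.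
have := bc_convex_hyp _ _ _ _ _ Cconv l01 l01 Cs Ct.
rewrite !scalerA !hypM scalerDr.
have -> : s / (s + t) / s = (s + t)^-1 by field; rewrite !gt_eqF.
suff -> : (1 - s / (s + t)) / t = (s + t)^-1 by [].
by field; rewrite !gt_eqF.
Qed.

Let gauge0 : gauge C 0 = 0.
Proof.
apply/eqP; rewrite eq_le gauge_ge0 andbT; apply/ler_addgt0Pr => e e0.
rewrite add0r; apply: gauge_le => //; rewrite scaler0.
by have [t _] := Cabs 0; rewrite scaler0.
Qed.

Let gaugeZ_le (u : R[i]) x : u != 0 ->
  gauge C (bc_of_complex u *: x) <= normc u * gauge C x.
Proof.
move=> u0.
have nu0 := normc_gt0 _ u0.
rewrite mulrC -ler_pdivrMr //; apply/ler_addgt0Pr => e e0.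
set t := gauge C x + e; have tx : gauge C x < t by rewrite ltrDl.
have t0 : 0 < t := le_lt_trans (gauge_ge0 x) tx.
rewrite ler_pdivrMr //; apply: gauge_le; first exact: mulr_gt0.
(* u / |u| lies in the disc *)
have -> : hyp (t * normc u)^-1 (t * normc u)^-1 *: (bc_of_complex u *: x) =
    (hyp (normc u)^-1 (normc u)^-1 * bc_of_complex u) *: (hyp t^-1 t^-1 *: x).
  by rewrite !scalerA mulrAC hypM -!invfM (mulrC t).
apply: Cbal; last exact: gauge_lt.
rewrite /hdisc idem1M idem2M !idem_hyp idem1_complex idem2_complex.
by rewrite !normcM !normc_real ger0_norm ?invr_ge0 ?normc_ge0 // mulVf ?gt_eqF.
Qed.

(** A unimodular complex number lies in the disc, which gives one inequality
    for [u]; the same inequality for its inverse gives the other. *)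
Lemma gaugeZ (u : R[i]) x :
  gauge C (bc_of_complex u *: x) = normc u * gauge C x.
Proof.
have [->|u0] := eqVneq u 0.
  by rewrite normc0 mul0r -(hyp_real 0) hyp00 scale0r gauge0.
apply/eqP; rewrite eq_le gaugeZ_le //=.
have := gaugeZ_le u^-1 (bc_of_complex u *: x).
rewrite invr_eq0 scalerA => /(_ u0).
have -> : bc_of_complex u^-1 * bc_of_complex u = 1.
  by apply: idem_inj; rewrite ?idem1M ?idem2M ?idem1_complex ?idem2_complex
    mulVf // -hyp11 idem_hyp.
by rewrite scale1r normcV mulrC ler_pdivlMr 1?mulrC // normc_gt0.
Qed.

(** On the range of [e1 = hyp 1 0] a bicomplex scalar acts through its first
    component, a complex number, to which [gaugeZ] applies. *)
Lemma gauge_hyp1Z z x :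
  gauge C (hyp 1 0 *: (z *: x)) = normc (idem1 z) * gauge C (hyp 1 0 *: x).
Proof.
rewrite -gaugeZ !scalerA; congr (gauge C (_ *: _)).
by apply: idem_inj; rewrite ?idem1M ?idem2M !idem_hyp ?idem1_complex
  ?idem2_complex ?mul0r ?mulr0 // mulrC.
Qed.

Lemma gauge_hyp2Z z x :
  gauge C (hyp 0 1 *: (z *: x)) = normc (idem2 z) * gauge C (hyp 0 1 *: x).
Proof.
rewrite -gaugeZ !scalerA; congr (gauge C (_ *: _)).
by apply: idem_inj; rewrite ?idem1M ?idem2M !idem_hyp ?idem1_complex
  ?idem2_complex ?mul0r ?mulr0 // mulrC.
Qed.

Lemma gauge_le1 x : C x ->
  gauge C (hyp 1 0 *: x) <= 1 /\ gauge C (hyp 0 1 *: x) <= 1.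
Proof.
move=> Cx; split; apply: gauge_le => //; rewrite invr1 hyp11 scale1r;
  by apply: Cbal => //; apply: hdisc_hyp; rewrite ?ler01 ?lexx.
Qed.

(** Convexity with the weight [e1], which is admissible since it has
    coordinates (1, 0): [e1 (e1 x) + (1 - e1) (e2 x) = x]. *)
Lemma gauge_lt1 x :
  gauge C (hyp 1 0 *: x) < 1 -> gauge C (hyp 0 1 *: x) < 1 -> C x.
Proof.
move=> x1 x2; have := gauge_lt _ _ x1; have := gauge_lt _ _ x2.
rewrite invr1 hyp11 !scale1r => C2 C1.
have b1 : 0 <= (1 : R) <= 1 by rewrite ler01 lexx.
have b0 : 0 <= (0 : R) <= 1 by rewrite ler01 lexx.
have := bc_convex_hyp _ _ _ _ _ Cconv b1 b0 C1 C2.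
rewrite !scalerA !hypM -scalerDl hypD subrr subr0 !(mulr0, mul1r, mul0r).
by rewrite addr0 add0r hyp11 scale1r.
Qed.

End GaugeTheory.
End Gauge.

(** * Neighbourhoods in a topological module *)

Section TopologicalModule.
Context {R : realType} {X : lmodType (bicomplex R)} {tau : topology_on X}.
Hypothesis Xtop : is_topological_module tau.
Local Notation T := (topspace tau).
Implicit Types (x y : T) (z : bicomplex R) (U : set T).

Lemma scale_continuousl z : continuous (fun x : T => z *: x).
Proof.
move=> x; have zx := @topmod_scale_continuous _ _ _ Xtop (z, x).
exact: cvg_comp2 (cvg_cst z) cvg_id zx.
Qed.

Lemma scale_continuousr x : continuous (fun z => z *: x : T).
Proof.
move=> z; have zx := @topmod_scale_continuous _ _ _ Xtop (z, x).
exact: cvg_comp2 cvg_id (cvg_cst x) zx.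
Qed.

Lemma add_continuousl y : continuous (fun x : T => x + y).
Proof.
move=> x; have xy := @topmod_add_continuous _ _ _ Xtop (x, y).
exact: cvg_comp2 cvg_id (cvg_cst y) xy.
Qed.

Lemma nbhs0_scale z U : nbhs (0 : T) U -> nbhs (0 : T) [set x | U (z *: x)].
Proof.
move=> U0; apply: (scale_continuousl z (0 : T)).
by rewrite /nbhs /= scaler0.
Qed.

Lemma nbhs_translate y U : nbhs y U <-> nbhs (0 : T) [set x | U (x + y)].
Proof.
split=> [Uy|U0].
  by apply: (add_continuousl y (0 : T)); rewrite /nbhs /= add0r.
have -> : U = [set x | [set x | U (x + y)] (x - y)].
  by apply/seteqP; split=> x /=; rewrite subrK.
by apply: (add_continuousl (- y) y); rewrite /nbhs /= subrr.
Qed.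

Lemma nbhs0_absorbing U x : nbhs (0 : T) U ->
  exists2 t, 0 < t & U (hyp t t *: x).
Proof.
move=> U0.
have /nbhs0_hdisc[t t0 tU] : nbhs (0 : bicomplex R) [set z | U (z *: x)].
  by apply: (scale_continuousr x); rewrite /nbhs /= scale0r.
by exists t => //; rewrite -[hyp t t]mulr1; apply: tU; exact: hdisc1.
Qed.

(** Joint continuity at (0, 0) gives a real [t > 0] and a neighbourhood [W] of 0
    such that [t z w] is in [U] for all [z] in the disc and [w] in [W]; hence
    [t W] lies in the core of [U]. *)
Lemma nbhs0_hcore U : nbhs (0 : T) U -> nbhs (0 : T) (hcore U).
Proof.
move=> U0.
have [[A W] /= [/nbhs0_hdisc[t t0 tA] W0] AWU] : nbhs ((0, 0) : bicomplex R * T)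
    [set p | U (p.1 *: p.2)].
  by apply: (topmod_scale_continuous Xtop); rewrite /nbhs /= scale0r.
apply: filterS (nbhs0_scale (hyp t^-1 t^-1) _ W0) => x /= Wx z dz.
have := AWU (hyp t t * z, hyp t^-1 t^-1 *: x) (conj (tA z dz) Wx).
by rewrite /= scalerA mulrC mulrA hypVK // mul1r.
Qed.

Lemma nbhs_separates x : (forall U, nbhs (0 : T) U -> U x) -> x = 0.
Proof.
move=> h; apply: contrapT => /eqP; rewrite eq_sym => x0.
have [A [Ao]] := hausdorff_accessible (topmod_hausdorff Xtop) x0.
rewrite !inE => A0 []; apply: h.
exact: open_nbhs_nbhs.
Qed.

(** * Hyperbolic balls and the topology *)

Section Normable.
Variables n1 n2 : T -> R.
Hypothesis nP : seminorm_pair n1 n2.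
Local Notation N := (fun x => hyp (n1 x) (n2 x)).
Local Notation balls := [set A : set T | exists x eps,
  [/\ hyperbolic eps, hlt 0 eps & A = hball N x eps]].

Lemma hball_hyp x a b :
  hball N x (hyp a b) = [set y | n1 (y - x) < a /\ n2 (y - x) < b].
Proof. by apply/seteqP; split=> y /= /hltE. Qed.

Lemma balls_hyp x a b : 0 < a -> 0 < b ->
  balls [set y | n1 (y - x) < a /\ n2 (y - x) < b].
Proof.
move=> a0 b0; exists x, (hyp a b); rewrite hball_hyp; split=> //.
  by exists a, b.
by apply/hlt0E; exists a, b.
Qed.

(** The witness is the open unit ball. *)
Lemma basis_bounded_convex_nbhs : basis balls ->
  exists B : set T, [/\ nbhs (0 : T) B, bc_bounded B & bc_convex B].
Proof.
move=> [bo bn]; exists [set x | n1 x < 1 /\ n2 x < 1]; split.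
- apply: open_nbhs_nbhs; split.
    have := balls_hyp 0 1 1 ltr01 ltr01 => /bo.
    by under eq_set do rewrite subr0.
  rewrite /= -(scale0r 0) -hyp00.
  by have [-> ->] := pair_hyp nP 0 0 0 (lexx _) (lexx _); rewrite !mul0r ltr01.
- move=> U /bn[V [[x [eps [_ /hlt0E[a [b [a0 b0 ->]]] ->]]]]].
  rewrite hball_hyp /= => -[x1 x2] VU.
  (* the ball of radius (c, d) around 0 lies in the given one around x *)
  pose c := a - n1 (0 - x); pose d := b - n2 (0 - x).
  have c0 : 0 < c by rewrite subr_gt0.
  have d0 : 0 < d by rewrite subr_gt0.
  exists (hyp c^-1 d^-1); split; first by exists c^-1, d^-1.
    by apply/hlt0E; exists c^-1, d^-1; rewrite !invr_gt0.
  move=> y /= [y1 y2]; exists (hyp c d *: y).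
    apply: VU => /=.
    have [] := pairD _ _ nP (hyp c d *: y) (0 - x); rewrite addrA addr0.
    have [-> ->] := pair_hyp nP c d y (ltW c0) (ltW d0).
    have : c * n1 y < c * 1 by rewrite ltr_pM2l.
    have : d * n2 y < d * 1 by rewrite ltr_pM2l.
    rewrite /c /d; lra.
  by rewrite scalerA hypVK // scale1r.
- move=> x y l [x1 x2] [y1 y2] [a [b [a0 b0 ->]]] _.
  rewrite -hyp11 => /hleE[a1 b1]; rewrite hypB /=.
  have [] := pairD _ _ nP (hyp a b *: x) (hyp (1 - a) (1 - b) *: y).
  have [-> ->] := pair_hyp nP a b x a0 b0.
  have [||-> ->] := pair_hyp nP (1 - a) (1 - b) y; rewrite ?subr_ge0 //.
  move=> h1 h2; split.
    by apply: le_lt_trans h1 _; exact: convex_lt1.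
  by apply: le_lt_trans h2 _; exact: convex_lt1.
Qed.

(** A set squeezed between the open and the closed unit ball determines the
    topology: being a neighbourhood of 0 makes balls open, being bounded makes
    them small. *)
Lemma bounded_nbhs_basis (C : set T) : nbhs (0 : T) C -> bc_bounded C ->
  (forall x, C x -> n1 x <= 1 /\ n2 x <= 1) ->
  (forall x, n1 x < 1 -> n2 x < 1 -> C x) -> basis balls.
Proof.
move=> C0 Cbd Cle Clt; split.
  move=> _ [x [_ [_ /hlt0E[a [b [a0 b0 ->]]] ->]]]; rewrite hball_hyp openE.
  move=> y /= [y1 y2]; apply/nbhs_translate.
  (* C only lies in the closed unit ball, so halving keeps the strict bounds *)
  pose c := (a - n1 (y - x)) / 2; pose d := (b - n2 (y - x)) / 2.
  have c0 : 0 < c by rewrite divr_gt0 // subr_gt0.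
  have d0 : 0 < d by rewrite divr_gt0 // subr_gt0.
  apply: filterS (nbhs0_scale (hyp c^-1 d^-1) _ C0) => w /= /Cle.
  have [||-> ->] := pair_hyp nP c^-1 d^-1 w; try by rewrite invr_ge0 ltW.
  rewrite !ler_pdivrMl // !mulr1 => -[w1 w2].
  have [] := pairD _ _ nP w (y - x); rewrite addrA.
  move: w1 w2; rewrite /c /d; lra.
move=> x U /nbhs_translate /Cbd[l [_ /hlt0E[a [b [a0 b0 ->]]] CU]].
exists [set y | n1 (y - x) < a^-1 /\ n2 (y - x) < b^-1].
  split; first by apply: balls_hyp; rewrite invr_gt0.
  rewrite /= subrr -(scale0r 0) -hyp00.
  have [-> ->] := pair_hyp nP 0 0 0 (lexx _) (lexx _).
  by rewrite !mul0r !invr_gt0.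
move=> y /= [y1 y2].
have /CU[u /= Uu uy] : C (hyp a b *: (y - x)).
  have [E1 E2] := pair_hyp nP a b (y - x) (ltW a0) (ltW b0).
  apply: Clt; first by rewrite E1 -ltr_pdivlMl // mulr1.
  by rewrite E2 -ltr_pdivlMl // mulr1.
have -> : y = u + x; last by [].
apply/eqP; rewrite -subr_eq; apply/eqP.
by rewrite -[LHS]scale1r -[RHS]scale1r -(hypVK a b a0 b0) -!scalerA uy.
Qed.

End Normable.

(** Separation of points: if both gauges vanish at [x], they vanish at every
    multiple of [x], so every multiple of [x] is in [C]; since [C] is bounded,
    [x] then lies in every neighbourhood of 0. *)
Lemma gauge_seminorm_pair (C : set T) : nbhs (0 : T) C -> bc_bounded C ->
  hbalanced C -> bc_convex C ->
  seminorm_pair (fun x => gauge C (hyp 1 0 *: x))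
                (fun x => gauge C (hyp 0 1 *: x)).
Proof.
move=> C0 Cbd Cbal Cconv.
have Cabs x : exists2 t, 0 < t & C (hyp t t *: x) by exact: nbhs0_absorbing.
split=> [x|x x1 x2|z x|x y].
- by split; exact: gauge_ge0.
- apply: nbhs_separates => U /Cbd[l [_ /hlt0E[a [b [a0 b0 ->]]] CU]].
  have /CU[u /= Uu uy] : C (hyp a b *: x).
    by apply: gauge_lt1 => //; rewrite ?gauge_hyp1Z ?gauge_hyp2Z // ?x1 ?x2
      mulr0.
  suff -> : x = u by [].
  by rewrite -[LHS]scale1r -[RHS]scale1r -(hypVK a b a0 b0) -!scalerA uy.
- by rewrite gauge_hyp1Z // gauge_hyp2Z.
- by rewrite !scalerDr; split; exact: gaugeD.
Qed.

End TopologicalModule.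

Theorem theorem5p12 (R : realType) (X : lmodType (bicomplex R))
    (tau : topology_on X) (Xtop : is_topological_module tau) :
  hnormable tau <->
  exists B : set (topspace tau),
    [/\ nbhs (0 : topspace tau) B, bc_bounded B & bc_convex B].
Proof.
split=> [[N /hnorm_seminorm_pair[n1 [n2 [nP ->]]]]|[B [B0 Bbd Bconv]]].
  exact: basis_bounded_convex_nbhs.
pose C := hcore B.
have C0 : nbhs (0 : topspace tau) C by exact: nbhs0_hcore.
have Cbd : bc_bounded C.
  by move=> U /Bbd[l [lh l0 BU]]; exists l; split=> // x /hcore_sub/BU.
have Cbal : hbalanced C by exact: hcore_balanced.
have Cconv : bc_convex C by exact: hcore_convex.
have nP := gauge_seminorm_pair Xtop C C0 Cbd Cbal Cconv.
have Cabs x : exists2 t, 0 < t & C (hyp t t *: x) by exact: nbhs0_absorbing.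
eexists; first exact: seminorm_pair_hnorm nP.
apply: bounded_nbhs_basis C0 Cbd _ _ => // x; first exact: gauge_le1.
exact: gauge_lt1.
Qed.
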